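(* Let $G=(V,E)$ be a locally finite directed graph, and suppose there are a partition $(S_k:k\in\mathbb{Z})$ of $V$ and an integer $m\ge 2$ such that: (A1) for all $k\in\mathbb{Z}$ and $x\in S_k$, $\mathrm{Out}(x)\subset S_{k+1}\cup\dots\cup S_{k+m-1}$; (A2) there is a graph automorphism $\phi$ of $G$ that maps $S_k$ to $S_{k+m}$ for every $k$, and such that $\mathrm{Out}(x)=\mathrm{In}(\phi(x))$ for all $x\in V$. For $k\in\mathbb{Z}$ let $D_k$ be the undirected graph with vertex set $S_k\cup\dots\cup S_{k+m-1}$ and an undirected edge between $x$ and $y$ whenever $(x,y)$ is a directed edge of $G$ (the graphs $D_k$ are all isomorphic), and let $D$ be a graph isomorphic to every $D_k$. Let $\lambda>0$. If there exist multiple Gibbs distributions for the hard-core model on $D$ with activity $\lambda$, then the trapping game on $G$ with $p=1/(1+\lambda)$ has positive probability of a draw from some vertex.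
   Context: For a vertex $x$ of a directed graph, $\mathrm{Out}(x)$ and $\mathrm{In}(x)$ denote its sets of out-neighbours and in-neighbours. **Trapping game on $G$ with parameter $p$.** Each vertex is independently a *trap* with probability $p$ and *open* with probability $1-p$. A token starts at some vertex; two players, who both know the whole configuration, move alternately. If the token is at $x$, a move consists of moving it to an open vertex in $\mathrm{Out}(x)$; if all vertices in $\mathrm{Out}(x)$ are traps, the player to move loses. A strategy for a player is a map assigning a legal move, where one exists, to each vertex; a winning strategy is one that results in a win for that player (in finitely many moves) whatever strategy the other player uses. The game from a vertex is a *draw* if neither player has a winning strategy. (By convention, if the starting vertex is a trap the game from it is regarded as a win for the first player.) **Hard-core model.** For an undirected graph with vertex set $W$ and $\lambda>0$, a Gibbs distribution for the hard-core model with activity $\lambda$ is a probability distribution of a configuration $\eta\in\{0,1\}^W$ such that, for every $v\in W$, $\mathbb{P}(\eta(v)=1\mid (\eta(w):w\ne v))$ equals $\frac{\lambda}{1+\lambda}$ if $\eta(w)=0$ for all neighbours $w$ of $v$, and equals $0$ otherwise. *)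

(* Defs.v *)
From HB Require Import structures.
From mathcomp Require Import all_boot all_order all_algebra.
From mathcomp Require Import all_classical all_reals all_analysis.
Set Implicit Arguments.
Unset Strict Implicit.
Unset Printing Implicit Defensive.
Import Order.TTheory GRing.Theory Num.Theory.
Local Open Scope classical_set_scope.
Local Open Scope ring_scope.

(* A directed graph on [V] is a relation [E : V -> V -> Prop]; an undirected
   graph is a symmetric such relation. *)

Definition out_nbrs (V : Type) (E : V -> V -> Prop) (x : V) : set V :=
  [set y | E x y].

Definition in_nbrs (V : Type) (E : V -> V -> Prop) (x : V) : set V :=
  [set y | E y x].

Definition locally_finite (V : Type) (E : V -> V -> Prop) : Prop :=
  forall x, finite_set (out_nbrs E x) /\ finite_set (in_nbrs E x).

Definition graph_iso (V W : Type) (E : V -> V -> Prop) (E' : W -> W -> Prop)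
    (f : V -> W) : Prop :=
  bijective f /\ forall x y, E x y <-> E' (f x) (f y).

Definition induced_undirected (V : Type) (E : V -> V -> Prop) (A : set V)
    (x y : A) : Prop :=
  E (val x) (val y) \/ E (val y) (val x).

(* [layers S a b] is the union of the [S i] with [a <= i <= b]. *)
Definition layers (V : Type) (S : int -> set V) (a b : int) : set V :=
  \bigcup_(i in [set i : int | a <= i <= b]) S i.

(* The events that depend on a single coordinate lying in [U]; they generate
   the sigma-algebra of the coordinates in [U]. *)
Definition coord_events (V : Type) (U : set V) : set (set (V -> bool)) :=
  \bigcup_(v in U)
    preimage_set_system setT (fun eta : V -> bool => eta v) measurable.

(* {0,1}^V with the product sigma-algebra *)
Notation config V := (g_sigma_algebraType (coord_events [set: V])).

(* [P] is the product over [V] of Bernoulli([p]) laws, given by its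
   finite-dimensional distributions. *)
Definition bernoulli_product (R : realType) (V : Type) (p : R)
    (P : probability (config V) R) : Prop :=
  forall (n : nat) (f : 'I_n -> V) (b : 'I_n -> bool), injective f ->
    P [set omega : config V | forall i, omega (f i) = b i] =
    (\prod_(i < n) (if b i then p else 1 - p))%:E.

(* Trapping game: [omega x = true] means that [x] is a trap. *)

Definition moves (V : Type) (E : V -> V -> Prop) (omega : V -> bool) (x : V) :
    set V :=
  [set y | out_nbrs E x y /\ ~~ omega y].

(* The value of [sigma] at a vertex without legal move is irrelevant. *)
Definition strategy (V : Type) (E : V -> V -> Prop) (omega : V -> bool)
    (sigma : V -> V) : Prop :=
  forall x, moves E omega x !=set0 -> moves E omega x (sigma x).

(* Position of the token after [n] moves from [x]; the first player uses
   [sigma], the second player uses [tau]. Only meaningful as long as the game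
   has not ended. *)
Fixpoint token (V : Type) (sigma tau : V -> V) (x : V) (n : nat) : V :=
  if n is n'.+1 then
    (if odd n' then tau else sigma) (token sigma tau x n')
  else x.

Definition ends_at (V : Type) (E : V -> V -> Prop) (omega : V -> bool)
    (sigma tau : V -> V) (x : V) (n : nat) : Prop :=
  moves E omega (token sigma tau x n) = set0 /\
  forall i, (i < n)%N -> moves E omega (token sigma tau x i) !=set0.

(* The player who is stuck after [n] moves loses: it is the second player when
   [n] is odd. The game from a trap is a win for the first player. *)
Definition first_wins (V : Type) (E : V -> V -> Prop) (omega : V -> bool)
    (sigma tau : V -> V) (x : V) : Prop :=
  omega x \/ exists2 n, odd n & ends_at E omega sigma tau x n.

Definition second_wins (V : Type) (E : V -> V -> Prop) (omega : V -> bool)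
    (sigma tau : V -> V) (x : V) : Prop :=
  ~~ omega x /\ exists2 n, ~~ odd n & ends_at E omega sigma tau x n.

Definition draw (V : Type) (E : V -> V -> Prop) (omega : V -> bool) (x : V) :
    Prop :=
  ~ (exists2 sigma, strategy E omega sigma &
       forall tau, strategy E omega tau -> first_wins E omega sigma tau x) /\
  ~ (exists2 tau, strategy E omega tau &
       forall sigma, strategy E omega sigma ->
         second_wins E omega sigma tau x).

(* [g] is a version of the conditional probability of the event [B] given the
   sub-sigma-algebra [F]. *)
Definition cond_prob_version (d : measure_display) (T : measurableType d)
    (R : realType) (P : probability T R) (F : set (set T)) (B : set T)
    (g : T -> R) : Prop :=
  [/\ forall C : set R, measurable C -> F (g @^-1` C),
      P.-integrable setT (EFin \o g) &
      forall A, F A -> P (A `&` B) = (\int[P]_(x in A) (g x)%:E)%E].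

Definition hardcore_cond (R : realType) (W : Type) (adj : W -> W -> Prop)
    (lambda : R) (v : W) (eta : W -> bool) : R :=
  if `[< forall w, adj v w -> eta w = false >] then lambda / (1 + lambda)
  else 0.

Definition hardcore_gibbs (R : realType) (W : Type) (adj : W -> W -> Prop)
    (lambda : R) (mu : probability (config W) R) : Prop :=
  forall v : W,
    cond_prob_version mu <<s coord_events (~` [set v]) >>
      [set eta : config W | eta v = true] (hardcore_cond adj lambda v).

(* Distributions are compared on measurable sets only: the value of a measure
   elsewhere is unspecified. *)
Definition multiple_hardcore_gibbs (R : realType) (W : Type)
    (adj : W -> W -> Prop) (lambda : R) : Prop :=
  exists mu nu : probability (config W) R,
    [/\ hardcore_gibbs adj lambda mu, hardcore_gibbs adj lambda nu &
        exists2 A, measurable A & mu A <> nu A].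

(* Main.v *)
(* The graph D is the quotient of G by phi; let q : V -> W be the projection.
   By (A1) and (A2), q maps Out(x) bijectively onto the neighbours of q(x), so a
   vertex x is a win for the second player iff x is open and no out-neighbour
   is such a win: given the trap at x, this is the heat-bath update of the
   hard-core model at the site q(x). Gibbs distributions are invariant under
   these updates. Perform them, by decreasing level, at all vertices reachable
   in n moves from finitely many vertices of D_0: the resulting configuration
   there is determined by the traps, whatever the initial configuration,
   unless the game from one of these vertices is undecided after n moves.
   Without draws the probability of this exception tends to 0, so any two
   Gibbs distributions agree. *)

Require Import Defs.
From HB Require Import structures.
From mathcomp Require Import all_boot all_order all_algebra.
From mathcomp Require Import all_classical all_reals all_analysis.
From mathcomp Require Import zify ring lra.
Set Implicit Arguments.
Unset Strict Implicit.
Unset Printing Implicit Defensive.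
Import Order.TTheory GRing.Theory Num.Theory.
Local Open Scope classical_set_scope.
Local Open Scope ring_scope.

(** * The trapping game through finite horizons *)

Section Game.
Variables (V : choiceType) (E : V -> V -> Prop) (outs : V -> seq V).
Hypothesis outsP : forall x y, E x y <-> y \in outs x.

(* Whether the second player wins from [x], computed with a horizon of [n]
   moves at which positions count as [b] if [n] is even and as [~~ b] if [n] is
   odd. These parities make [status false n] increasing in [n] and
   [status true n] decreasing. *)
Fixpoint status (b : bool) (n : nat) (omega : V -> bool) (x : V) : bool :=
  if n is n'.+1 then
    ~~ omega x && all (fun y => ~~ status (~~ b) n' omega y) (outs x)
  else b.

(** The recursion negates and flips [b], so each monotonicity at [n.+1] comes from the other one at
    [n]; hence the joint induction. *)
Lemma statusS_homo (omega : V -> bool) (n : nat) (x : V) :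
  (status false n omega x -> status false n.+1 omega x) /\
  (status true n.+1 omega x -> status true n omega x).
Proof.
elim: n x => [//|n IH] x; split.
- move=> /andP[ox /allP h]; apply/andP; split=> //; apply/allP => y yx.
  by apply: contra (h _ yx) => /(proj2 (IH y)).
- move=> /andP[ox /allP h]; apply/andP; split=> //; apply/allP => y yx.
  by apply: contra (h _ yx) => /(proj1 (IH y)).
Qed.

Lemma status_false_homo (omega : V -> bool) (x : V) (n k : nat) :
  (n <= k)%N -> status false n omega x -> status false k omega x.
Proof.
by move=> /subnKC <-; elim: (k - n)%N => [|i IH] h; rewrite ?addn0 // addnS;
  apply/(proj1 (statusS_homo _ _ _))/IH.
Qed.

Lemma status_true_homo (omega : V -> bool) (x : V) (n k : nat) :
  (n <= k)%N -> status true k omega x -> status true n omega x.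
Proof.
move=> /subnKC <-; elim: (k - n)%N => [|i IH]; rewrite ?addn0 // addnS.
by move=> /(proj2 (statusS_homo _ _ _))/IH.
Qed.

Lemma movesP (omega : V -> bool) (x y : V) :
  moves E omega x y <-> y \in outs x /\ ~~ omega y.
Proof. by rewrite /moves /=; split => -[/outsP]. Qed.

Lemma tokenSl (sigma tau : V -> V) (x : V) (n : nat) :
  token sigma tau x n.+1 = token tau sigma (sigma x) n.
Proof.
elim: n => [//|n IH].
by rewrite [LHS]/= -/(token _ _ _ n.+1) IH /=; case: odd.
Qed.

Lemma ends_atSl (omega : V -> bool) (sigma tau : V -> V) (x : V) (n : nat) :
  moves E omega x !=set0 -> ends_at E omega tau sigma (sigma x) n ->
  ends_at E omega sigma tau x n.+1.
Proof.
move=> mx [h1 h2]; split; first by rewrite tokenSl.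
by case=> [_|i ilt]; rewrite ?tokenSl //; apply: h2.
Qed.

Lemma strategyW (omega : V -> bool) (Q : V -> V -> Prop) :
  (forall x, moves E omega x !=set0 -> exists2 y, moves E omega x y & Q x y) ->
  exists2 sigma, strategy E omega sigma &
    forall x, moves E omega x !=set0 -> Q x (sigma x).
Proof.
move=> h.
have /choice[sigma hs] : forall x, exists y,
    moves E omega x !=set0 -> moves E omega x y /\ Q x y.
  move=> x; have [/[dup] mx /h[y y1 y2]|mx] := pselect (moves E omega x !=set0).
    by exists y.
  by exists x.
by exists sigma => x /hs[].
Qed.

(** One positional strategy serves either player from every decided vertex: its moves make the
    horizon within which the game is decided shrink, so play ends. *)
Lemma winning_strategy (omega : V -> bool) :
  exists2 s, strategy E omega s & forall n x,
   (status false n omega x -> forall sigma, strategy E omega sigma ->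
     exists2 N, ~~ odd N & ends_at E omega sigma s x N) /\
   (~~ status true n omega x -> ~~ omega x -> forall tau, strategy E omega tau ->
     exists2 N, odd N & ends_at E omega s tau x N).
Proof.
have good x : ~~ omega x -> (exists n, ~~ status true n omega x) ->
    exists2 y, moves E omega x y &
      forall n, ~~ status true n.+1 omega x -> status false n omega y.
  (* The successor is chosen at the least decided horizon, hence independently of [n]; monotonicity
     of [status false] makes it valid for all larger horizons. *)
  move=> ox ex; case: (ex_minnP ex) => -[//|n] hn nmin.
  have [y yx hy] : exists2 y, y \in outs x & status false n omega y.
    move: hn => /=; rewrite ox /= => /allPn[y yx]; rewrite negbK; by exists y.
  exists y.
    apply/movesP; split=> //; move: hy; case: (n) => //= k /andP[] //.
  move=> k /nmin; rewrite ltnS => nk; exact: status_false_homo hy.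
have [s strs hs] : exists2 s, strategy E omega s & forall x,
    moves E omega x !=set0 -> ~~ omega x ->
    (exists n, ~~ status true n omega x) ->
    forall n, ~~ status true n.+1 omega x -> status false n omega (s x).
  apply: (@strategyW omega (fun x y => ~~ omega x ->
    (exists n, ~~ status true n omega x) ->
    forall n, ~~ status true n.+1 omega x -> status false n omega y)).
  move=> x [y xy].
  have [[ox ex]|hx] := pselect (~~ omega x /\ exists n, ~~ status true n omega x).
    by have [z z1 z2] := good _ ox ex; exists z.
  by exists y => // ox ex; case: hx.
exists s => //; elim=> [//|n IH] x; split.
- move=> /andP[ox /allP lx] sigma hsig.
  have [mx|/set0P/negP/negPn/eqP mx] := pselect (moves E omega x !=set0).
    have /movesP[yx oy] := hsig _ mx.
    have [N oN eN] := (IH (sigma x)).2 (lx _ yx) oy s strs.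
    have [N' oN' eN'] := (IH (sigma x)).2 (lx _ yx) oy sigma hsig.
    by exists N'.+1; [rewrite /= oN'|exact: ends_atSl].
  by exists 0%N => //; split.
- move=> nx ox tau htau.
  have [y my _] := good _ ox (ex_intro _ n.+1 nx).
  have mx : moves E omega x !=set0 by exists y.
  have hy := hs _ mx ox (ex_intro _ n.+1 nx) n nx.
  have [N oN eN] := (IH (s x)).1 hy tau htau.
  by exists N.+1; [rewrite /= oN|exact: ends_atSl].
Qed.

(* While it is this strategy's turn the token stays off the positions that the
   opponent wins in bounded time; finiteness of [outs x] is what makes a
   simultaneous horizon available. *)
Lemma nonlosing_strategy (omega : V -> bool) :
  exists2 s, strategy E omega s & forall x,
    ~~ omega x -> (forall n, ~~ status false n omega x) ->
    moves E omega x !=set0 /\ forall n, status true n omega (s x).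
Proof.
have good x : ~~ omega x -> (forall n, ~~ status false n omega x) ->
    exists2 y, moves E omega x y & forall n, status true n omega y.
  move=> ox nx; apply: contrapT => h.
  have {}h y : y \in outs x -> exists n, ~~ status true n omega y.
    move=> yx; apply: contrapT => hy; apply: h; exists y.
      apply/movesP; split=> //; apply/negP => oy; apply: hy; exists 1%N.
      by rewrite /= oy.
    by move=> n; apply: contrapT => /negP hn; apply: hy; exists n.
  have [n hn] : exists n, all (fun y => ~~ status true n omega y) (outs x).
    elim: (outs x) h => [|y l IH] h; first by exists 0%N.
    have [n hn] : exists n, all (fun y => ~~ status true n omega y) l.
      by apply: IH => z zl; apply: h; rewrite inE zl orbT.
    have [k hk] := h y (mem_head _ _).
    exists (maxn n k); apply/allP => z; rewrite inE => /orP[/eqP ->|zl].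
      by apply: contra hk; apply: status_true_homo; rewrite leq_maxr.
    apply: contra (allP hn _ zl); apply: status_true_homo; by rewrite leq_maxl.
  by have := nx n.+1; rewrite /= ox hn.
have [s strs hs] : exists2 s, strategy E omega s & forall x,
    moves E omega x !=set0 -> ~~ omega x ->
    (forall n, ~~ status false n omega x) ->
    forall n, status true n omega (s x).
  apply: (@strategyW omega (fun x y => ~~ omega x ->
    (forall n, ~~ status false n omega x) -> forall n, status true n omega y)).
  move=> x [y xy].
  have [[ox ex]|hx] :=
      pselect (~~ omega x /\ forall n, ~~ status false n omega x).
    by have [z z1 z2] := good _ ox ex; exists z.
  by exists y => // ox ex; case: hx.
exists s => // x ox nx; have [y my _] := good x ox nx.
have mx : moves E omega x !=set0 by exists y.
by split => // n; apply: hs.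
Qed.

(** A vertex decided at some horizon has a winning strategy; from one that is never decided,
    [nonlosing_strategy], used by either player, refutes any winning strategy of the other. *)
Lemma drawP (omega : V -> bool) (x : V) :
  draw E omega x <->
  forall n, status true n omega x && ~~ status false n omega x.
Proof.
split=> [[nf ns] n|hx].
  have [s strs hs] := winning_strategy omega.
  apply/andP; split; [apply: contrapT => /negP h|apply/negP => h].
    apply: nf; exists s => // tau htau.
    have [ox|ox] := boolP (omega x); first by left.
    by right; apply: (hs n x).2.
  apply: ns; exists s => // sigma hsigma; split; last exact: (hs n x).1.
  by move: h; case: (n) => //= k /andP[].
have [s strs hs] := nonlosing_strategy omega.
have hi n : status true n omega x by have /andP[] := hx n.
have lo n : ~~ status false n omega x by have /andP[] := hx n.
have ox : ~~ omega x by have := hi 1%N => /andP[].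
have step y z : (forall n, status true n omega y) -> moves E omega y z ->
    ~~ omega z /\ forall n, ~~ status false n omega z.
  move=> hy /movesP[zy oz]; split => // n.
  by have /andP[_ /allP] := hy n.+1; apply.
(* Invariant of a play in which [s] moves first: at the turns of [s] the position is open and never
   [status false]; at the opponent's turns it is always [status true]. Hence [s] is never stuck. *)
have inv sigma y n : ~~ omega y -> (forall k, ~~ status false k omega y) ->
    strategy E omega sigma ->
    (forall i, (i < n)%N -> moves E omega (token s sigma y i) !=set0) ->
    if odd n then forall k, status true k omega (token s sigma y n)
    else ~~ omega (token s sigma y n) /\
         forall k, ~~ status false k omega (token s sigma y n).
  move=> oy ly hsig; elim: n => [//|n IH] hm.
  have {IH} := IH (fun i h => hm i (ltnW h)).
  have mn := hm n (ltnSn n).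
  rewrite /=; case: odd => /= [h|[oz lz]].
    exact: step h (hsig _ mn).
  exact: (hs _ oz lz).2.
split=> -[s' strs' hs'].
  have [/(negP ox)//|[[|n] // nodd [e1 e2]]] := hs' s strs.
  (* Here [s] plays second, so the invariant is applied from the position after the opponent's first
     move, with the parity shifted by one. *)
  rewrite tokenSl in e1.
  have mx := e2 0%N isT.
  have [oy ly] := step _ _ hi (strs' _ mx).
  have := inv s' (s' x) n oy ly strs'.
  move: nodd; rewrite /= => /negbTE -> [].
    by move=> i ilt; have := e2 i.+1 ilt; rewrite tokenSl.
  by move=> oz lz; have [[z]] := hs _ oz lz; rewrite e1.
have [_ [n nodd [e1 e2]]] := hs' s strs.
have := inv s' x n ox lo strs' e2.
rewrite (negbTE nodd) => -[oz lz].
by have [[z]] := hs _ oz lz; rewrite e1.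
Qed.

End Game.

(** * Heat-bath updates driven by the traps *)

Definition heat_bath (W : eqType) (adj : W -> W -> Prop) (t : bool) (w : W)
    (eta : W -> bool) : W -> bool :=
  fun v => if v == w then ~~ t && `[< forall u, adj w u -> eta u = false >]
           else eta v.

(** [foldr] applies the update of the head last, so a list sorted by increasing level is run by
    decreasing level. *)
Definition run (V : Type) (W : eqType) (adj : W -> W -> Prop) (q : V -> W)
    (omega : V -> bool) (L : seq V) (eta : W -> bool) : W -> bool :=
  foldr (fun x => heat_bath adj (omega x) (q x)) eta L.

Section Sandwich.
Variables (V : choiceType) (W : eqType) (outs : V -> seq V).
Variables (adj : W -> W -> Prop) (q : V -> W) (lev : V -> int) (m : int).
Hypothesis lev_outs : forall x y, y \in outs x -> lev x < lev y < lev x + m.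
Hypothesis adj_q :
  forall x w, adj (q x) w <-> exists2 y, y \in outs x & q y = w.
Hypothesis q_inj :
  forall x y, lev x <= lev y < lev x + m -> q x = q y -> x = y.

(** Certifies that [L] contains every vertex within [n] moves of [x]; [status] with horizon [n.+1]
    at [x] then reads traps in [L] only. *)
Fixpoint explored (L : seq V) (n : nat) (x : V) : bool :=
  (x \in L) && (if n is n'.+1 then all (explored L n') (outs x) else true).

Lemma explored_mem (L : seq V) (n : nat) (x : V) : explored L n x -> x \in L.
Proof. by case: n => [|n] /andP[]. Qed.

Lemma exploredS (L : seq V) (n : nat) (x y : V) :
  explored L n.+1 x -> y \in outs x -> explored L n y.
Proof. by move=> /andP[_ /allP]; apply. Qed.

Lemma explored_sub (L L' : seq V) (n : nat) (x : V) :
  {subset L <= L'} -> explored L n x -> explored L' n x.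
Proof.
move=> LL'; elim: n x => [|n IH] x /= /andP[xL h]; rewrite LL' //=.
by apply/allP => y /(allP h)/IH.
Qed.

(** Moves strictly raise the level, so no play from [y] reaches a different vertex [x] whose level
    is not higher. *)
Lemma explored_behead (L : seq V) (n : nat) (x y : V) :
  lev x <= lev y -> y != x -> explored (x :: L) n y -> explored L n y.
Proof.
elim: n y => [|n IH] y xy ynx /= /andP[]; rewrite inE (negbTE ynx) /= => -> //.
move=> /allP h; apply/allP => z zy; have /andP[yz _] := lev_outs zy.
apply: IH; last exact: h.
  exact: le_trans (ltW yz).
by apply/eqP => zx; move: yz; rewrite zx ltNge xy.
Qed.

Lemma exploration (U : seq V) (n : nat) (c : int) :
  (forall u, u \in U -> c <= lev u) ->
  exists2 L, (forall x, x \in L -> c <= lev x) &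
             (forall u, u \in U -> explored L n u).
Proof.
elim: n U => [|n IH] U hU.
  by exists U => // u uU; rewrite /= uU.
have [x xO|L hL exL] := IH (flatten [seq outs u | u <- U]).
  have /flatten_mapP[u uU /lev_outs /andP[ux _]] := xO.
  exact: le_trans (hU _ uU) (ltW ux).
exists (U ++ L) => [x|u uU].
  by rewrite mem_cat => /orP[/hU|/hL].
rewrite /= mem_cat uU /=; apply/allP => y yu.
apply: (@explored_sub L); first by move=> z zL; rewrite mem_cat zL orbT.
by apply: exL; apply/flatten_mapP; exists u.
Qed.

(* Each vertex is updated after the vertices of higher level. When [x] is
   updated, the last update at the site [q y], for [y \in outs x], was the one
   at [y], since the levels of the vertices above a site differ by at least
   [m]. *)
Lemma run_sandwich (omega : V -> bool) (eta : W -> bool) (L : seq V)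
    (n : nat) (y : V) :
  sorted (relpre lev <=%R) L -> uniq L ->
  (forall z, z \in L -> lev y < lev z + m) -> explored L n y ->
  (status outs false n.+1 omega y -> run adj q omega L eta (q y)) /\
  (run adj q omega L eta (q y) -> status outs true n.+1 omega y).
Proof.
elim: L n y => [|x L IH] n y; first by move=> _ _ _ /explored_mem.
rewrite [sorted _ _]/= => xL /= /andP[xnL uL] hy exy.
have xmin z : z \in L -> lev x <= lev z.
  have tr : transitive (relpre lev <=%R) by move=> a b c; exact: le_trans.
  by move: z; apply/allP; exact: order_path_min xL.
have {}IH n' z := IH n' z (path_sorted xL) uL.
rewrite {1 2}/heat_bath.
have [qyx|/eqP qyx] := eqVneq (q y) (q x); last first.
  have ynx : y != x by apply/eqP => yx; apply: qyx; rewrite yx.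
  have yL : y \in L.
    by have := explored_mem exy; rewrite inE (negbTE ynx).
  apply: IH => [z zL|]; first by apply: hy; rewrite inE zL orbT.
  exact: explored_behead (xmin _ yL) ynx exy.
have yx : y = x.
  have := explored_mem exy; rewrite inE => /orP[/eqP //|yL].
  by apply/esym/q_inj => //; rewrite xmin //= hy ?mem_head.
rewrite {}yx {y qyx} in hy exy *.
have step (z : V) : z \in outs x ->
    (status outs false n omega z -> run adj q omega L eta (q z)) /\
    (run adj q omega L eta (q z) -> status outs true n omega z).
  move=> zx; have /andP[xz zxm] := lev_outs zx.
  (* With [n = 0] the out-neighbours may be missing from [L], but [status] at horizon 0 is the
     constant [b], so both implications are trivial. *)
  case: n exy => [|n] exy; first by [].
  apply: IH => [t tL|].
    by apply: (lt_le_trans zxm); rewrite lerD2r xmin.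
  apply: (@explored_behead _ _ x); first exact: ltW.
    by apply/eqP => zx'; move: xz; rewrite zx' ltxx.
  exact: exploredS exy zx.
split=> /andP[ox]; rewrite /= ?ox /=.
- move=> /allP h; rewrite /status; apply/asboolP => w /adj_q[z zx <-].
  by apply/negbTE; apply: contra (h _ zx) => /(proj2 (step _ zx)).
- move=> /asboolP h; apply/allP => z zx.
  by apply/negP => /(proj1 (step _ zx)); rewrite h //; apply/adj_q; exists z.
Qed.

End Sandwich.

(** * Measurability of finite-horizon events *)

Lemma measurable_coord (V : Type) (v : V) (b : bool) :
  measurable [set omega : config V | omega v = b].
Proof.
apply: sub_sigma_algebra; exists v => //; exists [set b] => //.
by rewrite setTI.
Qed.

Lemma measurable_agree (V : choiceType) (s : seq V) (omega0 : V -> bool) :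
  measurable [set omega : config V | {in s, omega =1 omega0}].
Proof.
elim: s => [|x s IH].
  by rewrite (_ : [set _ | _] = setT) //; apply/seteqP; split.
rewrite (_ : [set _ | _] = [set omega : config V | omega x = omega0 x] `&`
    [set omega : config V | {in s, omega =1 omega0}]).
  by apply: measurableI => //; exact: measurable_coord.
apply/seteqP; split=> omega.
  move=> h; split; first by apply: h; rewrite mem_head.
  by move=> z zs; apply: h; rewrite inE zs orbT.
by case=> hx hs z; rewrite inE => /orP[/eqP ->|/hs].
Qed.

Lemma measurable_status (V : choiceType) (outs : V -> seq V) (b : bool) (n : nat)
    (x : V) : measurable [set omega : config V | status outs b n omega x].
Proof.
elim: n b x => [|n IH] b x /=.
  by case: b; [rewrite (_ : [set _ | _] = setT)|rewrite (_ : [set _ | _] = set0)];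
    rewrite //; apply/seteqP; split.
rewrite (_ : [set _ | _] = [set omega : config V | omega x = false] `&`
  [set omega | all (fun y => ~~ status outs (~~ b) n omega y) (outs x)]);
  last first.
  by apply/seteqP; split=> omega /= => [/andP[/negbTE]|[/negbT-> ->]].
apply: measurableI; first exact: measurable_coord.
elim: (outs x) => [|y l IHl] /=.
  by rewrite (_ : [set _ | _] = setT) //; apply/seteqP; split.
rewrite (_ : [set _ | _] =
  ~` [set omega : config V | status outs (~~ b) n omega y] `&`
  [set omega | all (fun y => ~~ status outs (~~ b) n omega y) l]); last first.
  by apply/seteqP; split=> omega /= => [/andP[/negP]|[/negP -> ->]].
by apply: measurableI => //; exact: measurableC.
Qed.

(** * Finite averages over Bernoulli traps *)

Section BernoulliMean.
Variables (R : realType) (V : choiceType) (p : R).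

(** Expectation of [F] when the traps in [L] are drawn afresh and the others kept as in [omega];
    being a finite sum, it makes sense for every [F]. *)
Fixpoint bernoulli_mean (L : seq V) (F : (V -> bool) -> R)
    (omega : V -> bool) : R :=
  if L is x :: L' then
    p * bernoulli_mean L' F [eta omega with x |-> true] +
    (1 - p) * bernoulli_mean L' F [eta omega with x |-> false]
  else F omega.

Lemma eq_bernoulli_mean (L : seq V) (F F' : (V -> bool) -> R)
    (omega : V -> bool) :
  (forall omega', (forall z, z \notin L -> omega' z = omega z) ->
     F omega' = F' omega') ->
  bernoulli_mean L F omega = bernoulli_mean L F' omega.
Proof.
elim: L omega => [|x L IH] omega h /=; first exact: h.
have step b : bernoulli_mean L F [eta omega with x |-> b] =
              bernoulli_mean L F' [eta omega with x |-> b].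
  apply: IH => omega' h'; apply: h => z.
  rewrite inE negb_or => /andP[zx zL].
  by rewrite h' //= (negbTE zx).
by rewrite !step.
Qed.

Lemma bernoulli_mean_dist (L : seq V) (F F' G : (V -> bool) -> R)
    (omega : V -> bool) :
  0 <= p <= 1 -> (forall omega', `|F omega' - F' omega'| <= G omega') ->
  `|bernoulli_mean L F omega - bernoulli_mean L F' omega| <=
  bernoulli_mean L G omega.
Proof.
move=> /andP[p0 p1] h; elim: L omega => [|x L IH] omega /=; first exact: h.
rewrite opprD addrACA -!mulrBr (le_trans (ler_normD _ _)) //.
rewrite !normrM (ger0_norm p0) (ger0_norm (_ : 0 <= 1 - p)) ?subr_ge0 //.
by rewrite lerD // ler_wpM2l // subr_ge0.
Qed.

Variable P : probability (config V) R.
Hypothesis hP : bernoulli_product p P.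

Lemma bernoulli_agree (s : seq V) (omega0 : V -> bool) : uniq s ->
  P [set omega : config V | {in s, omega =1 omega0}] =
  (\prod_(x <- s) (if omega0 x then p else 1 - p))%:E.
Proof.
move=> us.
have := @hP _ (tnth (in_tuple s)) (fun i => omega0 (tnth (in_tuple s) i)).
rewrite -(big_tnth _ _ _ xpredT (fun x => if omega0 x then p else 1 - p)) => <-.
  congr (P _); apply/seteqP; split=> omega /= h.
    by move=> i; apply: h; rewrite mem_tnth.
  by move=> x xs; have [i ->] := (tnthP (in_tuple s) x xs).
by apply/tuple_uniqP.
Qed.

(** The list [s] of coordinates already fixed serves the induction on [L]: the head of [L] moves to
    [s], and the event splits by its value. *)
Lemma bernoulli_meanE (s L : seq V) (G : set (config V)) (omega0 : V -> bool) :
  measurable G ->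
  (forall omega omega' : V -> bool, {in s ++ L, omega =1 omega'} ->
     G omega -> G omega') ->
  uniq (s ++ L) ->
  P (G `&` [set omega : config V | {in s, omega =1 omega0}]) =
  ((\prod_(x <- s) (if omega0 x then p else 1 - p)) *
   bernoulli_mean L (\1_G) omega0)%:E.
Proof.
move=> mG; elim: L s omega0 => [|x L IH] s omega0.
  rewrite cats0 => hG us; rewrite /= indicE.
  have [/set_mem Go|/negP Go] := boolP (omega0 \in G).
    rewrite mulr1 -bernoulli_agree //; congr (P _); apply/setIidPr => omega /= h.
    by apply: hG Go => z zs; rewrite h.
  rewrite mulr0 (_ : _ `&` _ = set0) ?measure0 //.
  apply/seteqP; split=> // omega /= [Gom h]; apply: Go; apply/mem_set.
  exact: hG Gom.
move=> hG us.
have perm : perm_eq (s ++ x :: L) ((x :: s) ++ L).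
  by rewrite -cat1s catA perm_cat2r perm_catC.
have xs : x \notin s.
  by move: us; rewrite (perm_uniq perm) /= mem_cat negb_or => /andP[/andP[]].
have {}IH b : P ((G `&` [set omega : config V | {in s, omega =1 omega0}]) `&`
    [set omega | omega x = b]) =
  ((if b then p else 1 - p) * (\prod_(x <- s) (if omega0 x then p else 1 - p)) *
   bernoulli_mean L (\1_G) [eta omega0 with x |-> b])%:E.
  have := IH (x :: s) [eta omega0 with x |-> b].
  rewrite big_cons /= eqxx.
  rewrite (eq_big_seq (fun x => if omega0 x then p else 1 - p)); last first.
    move=> z zs /=; case: eqVneq => // zx; by rewrite -zx zs in xs.
  move=> <-.
  - rewrite -setIA; congr (P (_ `&` _)); apply/seteqP; split=> omega /=.
      move=> [h hx] z; rewrite inE => /orP[/eqP ->|zs]; first by rewrite /= eqxx.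
      by rewrite /= h //; case: eqVneq => // zx; rewrite -zx zs in xs.
    move=> h; split; last by rewrite h ?mem_head //= eqxx.
    move=> z zs; rewrite h ?inE ?zs ?orbT //=.
    by case: eqVneq => // zx; rewrite -zx zs in xs.
  - by move=> om om' h; apply: hG => z; rewrite (perm_mem perm); exact: h.
  - by move: us; rewrite (perm_uniq perm).
have mA : measurable (G `&` [set omega : config V | {in s, omega =1 omega0}]).
  by apply: measurableI => //; exact: measurable_agree.
set w := \prod_(y <- s) _.
have -> : w * bernoulli_mean (x :: L) \1_G omega0 =
    p * w * bernoulli_mean L \1_G [eta omega0 with x |-> true] +
    (1 - p) * w * bernoulli_mean L \1_G [eta omega0 with x |-> false].
  by rewrite /=; ring.
rewrite EFinD.
apply: etrans (measureDI P mA (measurable_coord x true)) _.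
rewrite addeC; congr (_ + _)%E; last exact: (IH true).
rewrite -(IH false); congr (P _); rewrite setDE; congr (_ `&` _).
by apply/seteqP; split=> omega /=; case: (omega x).
Qed.

Lemma bernoulli_mean_indic (L : seq V) (G : set (config V)) (omega0 : V -> bool) :
  measurable G ->
  (forall omega omega' : V -> bool, {in L, omega =1 omega'} ->
     G omega -> G omega') ->
  uniq L -> (bernoulli_mean L (\1_G) omega0)%:E = P G.
Proof.
move=> mG hG uL; have := @bernoulli_meanE [::] L G omega0 mG hG uL.
rewrite big_nil mul1r => <-; congr (P _); by apply/setIidPl => omega _.
Qed.

End BernoulliMean.

(** * Invariance of Gibbs distributions under heat-bath updates *)

Definition set_site (W : eqType) (w : W) (b : bool) (eta : W -> bool) :
    W -> bool := fun v => if v == w then b else eta v.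

Section HeatBath.
Variables (R : realType) (W : choiceType) (adj : W -> W -> Prop) (lambda : R).
Variable mu : probability (config W) R.
Hypothesis lambda_gt0 : 0 < lambda.
Hypothesis gibbs : hardcore_gibbs adj lambda mu.

Let free (w : W) : set (config W) :=
  [set eta | forall u, adj w u -> eta u = false].

Lemma measurable_off_site (w : W) (B : set (config W)) :
  <<s coord_events (~` [set w]) >> B -> measurable B.
Proof.
apply: sub_smallest2r; first exact: smallest_sigma_algebra.
by move=> A [v _ hA]; exists v.
Qed.

(** Overwriting the value at [w] hides that coordinate. The sets [B] whose preimage lies in the
    sigma-algebra off [w] form a sigma-algebra, so coordinate events suffice. *)
Lemma measurable_update (w : W) (b : bool) (B : set (config W)) :
  measurable B ->
  <<s coord_events (~` [set w]) >>
    (set_site w b @^-1` B).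
Proof.
pose f : config W -> config W := set_site w b.
move=> mB; rewrite -[_ @^-1` _](setTI (f @^-1` B)).
change (image_set_system setT f <<s coord_events (~` [set w]) >> B).
apply: (smallest_sub (C := sigma_algebra setT)) mB.
  by apply: sigma_algebra_image; exact: smallest_sigma_algebra.
move=> _ [v _ [Y mY <-]]; rewrite /image_set_system /= !setTI.
have [vw|vw] := eqVneq v w; last first.
  apply: sub_sigma_algebra; exists v; first exact/eqP.
  exists Y => //; rewrite setTI; apply/seteqP; split=> eta /=;
    by rewrite /f /set_site (negbTE vw).
have fv eta : f eta v = b by rewrite /f /set_site vw eqxx.
have [bY|bY] := pselect (Y b).
  rewrite (_ : _ @^-1` _ = ~` set0).
    by apply: sigma_algebraC; exact: sigma_algebra0.
  by apply/seteqP; split=> eta h //; rewrite /preimage /= fv.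
rewrite (_ : _ @^-1` _ = set0); first exact: sigma_algebra0.
by apply/seteqP; split=> eta //; rewrite /preimage /= fv.
Qed.

Lemma hardcore_condE (w : W) (eta : config W) :
  hardcore_cond adj lambda w eta = lambda / (1 + lambda) * \1_(free w) eta.
Proof.
rewrite /hardcore_cond indicE; case: asboolP => h.
  by rewrite mem_set // mulr1.
by rewrite memNset // mulr0.
Qed.

Lemma activity_gt0 : 0 < lambda / (1 + lambda).
Proof. by rewrite divr_gt0 // addr_gt0. Qed.

(** Measurability comes from the Gibbs property itself: [free w] is a level set of the conditional
    probability, whose two possible values differ. *)
Lemma measurable_free (w : W) : measurable (free w).
Proof.
apply: (@measurable_off_site w).
have [/(_ [set lambda / (1 + lambda)] (measurable_set1 _)) + _ _] := gibbs w.
congr (<<s _ >> _); apply/seteqP; split=> eta /=; rewrite hardcore_condE indicE.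
  have [/set_mem //|_] := boolP (eta \in free w).
  by rewrite mulr0 => /esym h; have := activity_gt0; rewrite h ltxx.
by move=> h; rewrite mem_set // mulr1.
Qed.

Lemma gibbs_occupied (w : W) (A : set (config W)) :
  <<s coord_events (~` [set w]) >> A ->
  mu (A `&` [set eta | eta w = true]) =
  ((lambda / (1 + lambda))%:E * mu (A `&` free w))%E.
Proof.
move=> hA; have [_ _ /(_ _ hA) ->] := gibbs w.
have mA := measurable_off_site hA.
under eq_integral do rewrite hardcore_condE EFinM.
rewrite integralZl //; last first.
  apply: (integrableS measurableT) => //.
  exact: integrable_indic (measurable_free w).
by rewrite integral_indic //; [rewrite setIC|exact: measurable_free].
Qed.

Lemma heat_bath_preimage_true (w : W) (B : set (config W)) :
  heat_bath adj true w @^-1` B =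
  set_site w false @^-1` B.
Proof. by []. Qed.

Lemma heat_bath_preimage_false (w : W) (B : set (config W)) :
  heat_bath adj false w @^-1` B =
  ((set_site w true @^-1` B) `&` free w) `|`
  ((set_site w false @^-1` B) `\` free w).
Proof.
have hb (eta : config W) :
    heat_bath adj false w eta = set_site w `[< free w eta >] eta by [].
apply/seteqP; split=> eta /=; rewrite hb; case: asboolP => h; first by left.
- by right.
- by case=> [[]//|[]].
- by case=> [[]//|[]].
Qed.

Lemma measurable_heat_bath (t : bool) (w : W) (B : set (config W)) :
  measurable B -> measurable (heat_bath adj t w @^-1` B : set (config W)).
Proof.
move=> mB; have mU b := measurable_off_site (@measurable_update w b _ mB).
case: t; first by rewrite heat_bath_preimage_true.
have mf := measurable_free w.
rewrite heat_bath_preimage_false; apply: measurableU.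
  exact: measurableI.
exact: measurableD.
Qed.

(** Averaged over the trap, the update resamples the site [w] from its conditional law. The events
    [U b] ignore [w], which reduces the claim to a linear identity between the measures of [U b] and
    of its intersection with [free w]. *)
Lemma gibbs_heat_bath (w : W) (B : set (config W)) : measurable B ->
  fine (mu B) = (1 / (1 + lambda)) * fine (mu (heat_bath adj true w @^-1` B)) +
    (1 - 1 / (1 + lambda)) * fine (mu (heat_bath adj false w @^-1` B)).
Proof.
move=> mB.
pose U b : set (config W) := set_site w b @^-1` B.
have hU b : <<s coord_events (~` [set w]) >> (U b) by exact: measurable_update.
have mU b : measurable (U b) by exact: measurable_off_site (hU b).
have mf := measurable_free w.
pose m A := fine (mu A).
have split_m A C : measurable A -> measurable C ->
    m A = m (A `\` C) + m (A `&` C).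
  move=> mA mC; rewrite /m (measureDI mu mA mC) fineD //;
    apply: fin_num_measure; [exact: measurableD|exact: measurableI].
have occ b : m (U b `&` [set eta | eta w = true]) =
    lambda / (1 + lambda) * m (U b `&` free w).
  rewrite /m gibbs_occupied // fineM //; apply: fin_num_measure.
  exact: measurableI.
have mw := measurable_coord w true.
(* Writing at [w] the value already there changes nothing, so [B] may be replaced by [U b] where
   [eta w = b]. *)
have hB : m B = m (U false `\` [set eta | eta w = true]) +
                m (U true `&` [set eta | eta w = true]).
  rewrite (split_m _ _ mB mw).
  have upd (eta : config W) : set_site w (eta w) eta = eta.
    by apply/funext => z; rewrite /set_site; case: eqVneq => // ->.
  congr (m _ + m _); apply/seteqP; split=> eta /= [].
  - move=> Beta hw; split=> //; rewrite /U /=.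
    have -> : false = eta w by case: (eta w) hw.
    by rewrite upd.
  - rewrite /U /= => + hw; have -> : false = eta w by case: (eta w) hw.
    by rewrite upd.
  - by move=> Beta hw; split=> //; rewrite /U /= -hw upd.
  - by rewrite /U /= => + hw; rewrite -{1}hw upd.
have hF : m (heat_bath adj false w @^-1` B) =
    m (U true `&` free w) + m (U false `\` free w).
  rewrite heat_bath_preimage_false -/(U true) -/(U false) /m measureU //.
  - rewrite fineD //; apply: fin_num_measure.
      exact: measurableI.
    exact: measurableD.
  - exact: measurableI.
  - exact: measurableD.
  - by apply/seteqP; split=> eta // -[[_ h] [_ nh]]; exact: nh.
have h1 := split_m _ _ (mU false) mw.
have h2 := split_m _ _ (mU false) mf.
have o1 := occ false; have o2 := occ true.
rewrite heat_bath_preimage_true -/(U false) -!/(m _) hB hF.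
have l0 : 1 + lambda != 0 by rewrite gt_eqF // addr_gt0.
have -> : 1 - 1 / (1 + lambda) = lambda / (1 + lambda) by field.
rewrite o2.
have -> : m (U false `\` [set eta | eta w = true]) =
    m (U false) - lambda / (1 + lambda) * m (U false `&` free w).
  by rewrite -o1 h1 addrK.
have -> : m (U false `\` free w) = m (U false) - m (U false `&` free w).
  by rewrite h2 addrK.
by field.
Qed.

End HeatBath.

(** * The quotient of the directed graph by the automorphism *)

Section Projection.
Variables (V W : choiceType) (E : V -> V -> Prop).
Variables (lev : V -> int) (m : int) (phi : V -> V).
Hypothesis m_ge2 : 2 <= m.
Hypothesis lev_E : forall x y, E x y -> lev x < lev y < lev x + m.
Hypothesis phi_bij : bijective phi.
Hypothesis phi_E : forall x y, E x y <-> E (phi x) (phi y).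
Hypothesis phi_lev : forall x, lev (phi x) = lev x + m.
Hypothesis phi_in : forall x y, E x y <-> E y (phi x).
Variables (adj : W -> W -> Prop) (f : W -> V).
Hypothesis f_inj : injective f.
Hypothesis f_lev : forall w, 0 <= lev (f w) < m.
Hypothesis f_surj : forall x, 0 <= lev x < m -> exists w, f w = x.
Hypothesis f_adj : forall w w', adj w w' <-> E (f w) (f w') \/ E (f w') (f w).

(** Membership in the same orbit of [phi], with natural exponents on both sides in place of negative
    powers. *)
Let orbit (x y : V) := exists a b, iter a phi x = iter b phi y.

Let iter_lev a x : lev (iter a phi x) = lev x + m *+ a.
Proof. by elim: a => [|a IH]; rewrite ?addr0 //= phi_lev IH mulrSr addrA. Qed.

Let iter_inj a : injective (iter a phi).
Proof.
elim: a => [|a IH] x y //= /(bij_inj phi_bij); exact: IH.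
Qed.

Let iter_surj a y : exists x, iter a phi x = y.
Proof.
have [g _ gK] := phi_bij; elim: a y => [|a IH] y; first by exists y.
by have [x hx] := IH (g y); exists x; rewrite /= hx gK.
Qed.

Let iter_E a x y : E x y <-> E (iter a phi x) (iter a phi y).
Proof. by elim: a => [//|a IH] /=; rewrite IH phi_E. Qed.

Let orbit_sym x y : orbit x y -> orbit y x.
Proof. by move=> [a [b h]]; exists b, a. Qed.

Let orbit_trans x y z : orbit x y -> orbit y z -> orbit x z.
Proof.
move=> [a [b h]] [c [d h']]; exists (c + a)%N, (b + d)%N.
by rewrite iterD h -iterD addnC iterD h' -iterD.
Qed.

(** Levels along an orbit differ by multiples of [m], and a window of length [2m] leaves only the
    multiples 0 and 1. *)
Let orbit_near x y : orbit x y -> lev x <= lev y -> lev y < lev x + m *+ 2 ->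
  y = x \/ y = phi x.
Proof.
move=> [a [b h]] xy yx.
have hl := congr1 lev h; rewrite !iter_lev in hl.
have ab : (b <= a)%N.
  rewrite leqNgt; apply/negP => ba; move: hl; rewrite -(subnKC (ltnW ba)) mulrnDr.
  have : 0 < m *+ (b - a) by rewrite pmulrn_lgt0 ?subn_gt0 //; lia.
  by lia.
have {}h : iter (a - b) phi x = y.
  by apply: (@iter_inj b); rewrite -iterD subnKC.
have {}hl : lev y = lev x + m *+ (a - b) by rewrite -h iter_lev.
case: (a - b)%N h hl => [|[|k]] h hl; [by left|by right|].
have : 0 <= m *+ k by rewrite mulrn_wge0 //; lia.
by move: hl yx; rewrite !mulrSr mulr0n; lia.
Qed.

(** Every orbit meets the levels from 0 to [m - 1] in exactly one vertex; [q] sends the orbit to the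
    site that [f] places there. *)
Lemma orbit_projection : exists q : V -> W,
  [/\ forall x w, adj (q x) w <-> exists2 y, E x y & q y = w,
      forall x y, lev x <= lev y < lev x + m -> q x = q y -> x = y &
      forall w, q (f w) = w].
Proof.
have /choice[q hq] : forall x, exists w, orbit x (f w).
  (* From a nonnegative level, at most [k] applications of the inverse of [phi] lead into the
     window. *)
  have pos (k : nat) x : lev x < m *+ k.+1 -> 0 <= lev x ->
      exists w, orbit x (f w).
    elim: k x => [|k IH] x xk x0.
      by have [|w <-] := f_surj (x := x); [lia|exists w, 0%N, 0%N].
    have [xm|xm] := ltP (lev x) m.
      by have [|w <-] := f_surj (x := x); [lia|exists w, 0%N, 0%N].
    have [y /= yx] := iter_surj 1 x; have := phi_lev y; rewrite yx => hl.
    have [||w hw] := IH y; [by move: xk; rewrite mulrS; lia|by lia|].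
    by exists w; apply: orbit_trans hw; exists 0%N, 1%N.
  (* Any vertex is first raised: [|lev x|] applications of [phi] reach a nonnegative level because
     [m] is positive. *)
  move=> x; have : exists a y, iter a phi x = y /\ 0 <= lev y.
    exists `|lev x|%N, (iter `|lev x|%N phi x); split=> //; rewrite iter_lev.
    by rewrite -mulr_natr; nia.
  move=> [a [y [xy y0]]].
  have [||w hw] := pos `|lev y|%N y; [by rewrite -mulr_natr; nia|by []|].
  by exists w; apply: orbit_trans hw; exists a, 0%N.
have same x y : lev x <= lev y < lev x + m -> orbit x y -> x = y.
  move=> /andP[xy yx] /orbit_near[//||//|yphi]; first by lia.
  by move: yx; rewrite yphi phi_lev ltxx.
have qP x w : orbit x (f w) -> q x = w.
  move=> xw; have h := orbit_trans (orbit_sym (hq x)) xw.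
  have := f_lev (q x); have := f_lev w => l1 l2; apply: f_inj.
  have [le|lt] := leP (lev (f (q x))) (lev (f w)).
    by apply: same => //; lia.
  by apply/esym/same; [lia|exact: orbit_sym].
exists q; split=> [x w|x y xy qxy|w].
- have lift z : E (f (q x)) z -> exists2 y, E x y & orbit y z.
    move=> ez; have [a [b ab]] := hq x.
    have [y hy] := iter_surj a (iter b phi z).
    exists y; last by exists a, b.
    by apply/(iter_E a); rewrite ab hy -iter_E.
  (* An edge from [f w] into the representative [f (q x)] becomes, by [phi_in], an edge out of it to
     [phi (f w)]. *)
  split=> [/f_adj[/lift[y xy yw]|/phi_in/lift[y xy yw]]|[y xy <-]].
  + by exists y => //; exact: qP.
  + by exists y => //; apply: qP; apply: orbit_trans yw _; exists 0%N, 1%N.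
  have [b [a ab]] := hq x; have [z hz] := iter_surj a (iter b phi y).
  have ez : E (f (q x)) z by apply/(iter_E a); rewrite -ab hz -iter_E.
  have oz : orbit (f (q y)) z.
    by apply: orbit_trans (orbit_sym (hq y)) _; exists b, a.
  (* [z] has level strictly between 0 and [2m], so it is [f (q y)] or its image by [phi]; the second
     case is an edge from [f (q y)] to [f (q x)]. *)
  have := lev_E ez; have := f_lev (q x); have := f_lev (q y) => l1 l2 l3.
  have [lt|le] := ltP (lev z) (lev (f (q y))).
    have zq : z = f (q y) by apply: same; [lia|exact: orbit_sym].
    by apply/f_adj; left; rewrite -zq.
  have [||hz'|hz'] := orbit_near oz; rewrite ?mulr2n; [by lia|by lia| |].
    by apply/f_adj; left; rewrite -hz'.
  by apply/f_adj; right; apply/phi_in; rewrite -hz'.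
- apply: same => //; apply: orbit_trans (hq x) _; rewrite qxy; exact: orbit_sym.
- by apply: qP; exists 0%N, 0%N.
Qed.

End Projection.

(** * Agreement of Gibbs distributions in the absence of draws *)

Section Uniqueness.
Variables (R : realType) (V W : choiceType) (E : V -> V -> Prop).
Variables (outs : V -> seq V) (adj : W -> W -> Prop) (q : V -> W) (f : W -> V).
Variables (lev : V -> int) (m : int) (lambda : R).
Hypothesis outsP : forall x y, E x y <-> y \in outs x.
Hypothesis lev_outs : forall x y, y \in outs x -> lev x < lev y < lev x + m.
Hypothesis adj_q :
  forall x w, adj (q x) w <-> exists2 y, y \in outs x & q y = w.
Hypothesis q_inj :
  forall x y, lev x <= lev y < lev x + m -> q x = q y -> x = y.
Hypothesis fK : forall w, q (f w) = w.
Hypothesis f_lev : forall w, 0 <= lev (f w) < m.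
Hypothesis lambda_gt0 : 0 < lambda.
Variable P : probability (config V) R.
Hypothesis hP : bernoulli_product (1 / (1 + lambda)) P.

Lemma status_local (b : bool) (L : seq V) (n : nat) (x : V)
    (omega omega' : V -> bool) :
  {in L, omega =1 omega'} -> explored outs L n x ->
  status outs b n.+1 omega x = status outs b n.+1 omega' x.
Proof.
move=> h; elim: n b x => [|n IH] b x ex.
  by rewrite /= h // (explored_mem ex).
have statusS om : status outs b n.+2 om x =
  ~~ om x && all (fun y => ~~ status outs (~~ b) n.+1 om y) (outs x) by [].
rewrite !statusS h ?(explored_mem ex) //; congr (_ && _).
by apply: eq_in_all => y yx; rewrite (IH _ _ (exploredS ex yx)).
Qed.

Definition undecided (n : nat) (omega : V -> bool) (x : V) : bool :=
  status outs true n omega x && ~~ status outs false n omega x.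

Lemma measurable_undecided (n : nat) (x : V) :
  measurable [set omega : config V | undecided n omega x].
Proof.
rewrite (_ : [set _ | _] = [set omega : config V | status outs true n omega x] `\`
  [set omega | status outs false n omega x]).
  by apply: measurableD; exact: measurable_status.
by apply/seteqP; split=> omega /=;
  [move=> /andP[h /negP]|move=> [h /negP h']; apply/andP].
Qed.

Lemma drawE (x : V) : [set omega : config V | draw E omega x] =
  \bigcap_n [set omega : config V | undecided n omega x].
Proof.
apply/seteqP; split=> omega /=.
  by move=> /(drawP outsP) h n _; exact: h.
by move=> h; apply/(drawP outsP) => n; exact: h.
Qed.

Lemma measurable_draw (x : V) :
  measurable [set omega : config V | draw E omega x].
Proof.
by rewrite drawE; apply: bigcapT_measurable => n; exact: measurable_undecided.
Qed.

(** The undecided events decrease with the horizon and intersect to the draw event: continuity from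
    above. *)
Lemma undecided_cvg (x : V) : P [set omega : config V | draw E omega x] = 0%E ->
  P [set omega : config V | undecided n omega x] @[n --> \oo] --> 0%E.
Proof.
move=> <-; rewrite drawE; apply: nonincreasing_cvg_mu.
- apply: le_lt_trans (ltry 1).
  exact: probability_le1 (measurable_undecided _ _).
- by move=> n; exact: measurable_undecided.
- by rewrite -drawE; exact: measurable_draw.
move=> n k nk; apply/subsetPset => omega /= /andP[h1 h2]; apply/andP; split.
  exact: status_true_homo h1.
by apply: contra h2; exact: status_false_homo.
Qed.

Lemma has_undecided_cons (n : nat) (x : V) (U : seq V) :
  [set omega : config V | has (undecided n omega) (x :: U)] =
  [set omega | undecided n omega x] `|` [set omega | has (undecided n omega) U].
Proof. by apply/seteqP; split=> omega /= /orP. Qed.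

Lemma measurable_has_undecided (n : nat) (U : seq V) :
  measurable [set omega : config V | has (undecided n omega) U].
Proof.
elim: U => [|x U IH]; last first.
  rewrite has_undecided_cons; apply: measurableU => //.
  exact: measurable_undecided.
by rewrite (_ : [set _ | _] = set0) //; apply/seteqP; split.
Qed.

Lemma has_undecided_cvg (U : seq V) :
  (forall x, x \in U -> P [set omega : config V | draw E omega x] = 0%E) ->
  P [set omega : config V | has (undecided n omega) U] @[n --> \oo] --> 0%E.
Proof.
elim: U => [|x U IH] h.
  rewrite (_ : (fun n => _) = cst 0%E); first exact: cvg_cst.
  by apply/funext => n /=; rewrite (_ : [set _ | _] = set0) ?measure0 //;
    apply/seteqP; split.
have cU : P [set omega : config V | has (undecided n omega) U]
    @[n --> \oo] --> 0%E.
  by apply: IH => y yU; apply: h; rewrite inE yU orbT.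
have cx := undecided_cvg (h x (mem_head _ _)).
apply: (@squeeze_cvge _ _ _ _ (cst 0%E) _ (fun n =>
  P [set omega : config V | undecided n omega x] +
  P [set omega : config V | has (undecided n omega) U])%E).
- apply: nearW => n; rewrite measure_ge0 /= has_undecided_cons.
  apply: measureU2; first exact: measurable_undecided.
  exact: measurable_has_undecided.
- exact: cvg_cst.
- by rewrite -[X in _ --> X]adde0; apply: cvgeD.
Qed.

Section Run.
Variable mu : probability (config W) R.
Hypothesis gibbs : hardcore_gibbs adj lambda mu.

Lemma measurable_run (omega : V -> bool) (L : seq V) (B : set (config W)) :
  measurable B -> measurable (run adj q omega L @^-1` B : set (config W)).
Proof.
move=> mB; elim: L B mB => [//|x L IH] B mB.
exact: (IH _ (measurable_heat_bath lambda_gt0 gibbs (omega x) (q x) mB)).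
Qed.

(** Each update preserves [mu] on average over its own trap, and [L] has no repetition, so the traps
    can be averaged one vertex at a time. *)
Lemma gibbs_run (L : seq V) (B : set (config W)) (omega0 : V -> bool) :
  measurable B -> uniq L ->
  bernoulli_mean (1 / (1 + lambda)) L
    (fun omega => fine (mu (run adj q omega L @^-1` B))) omega0 = fine (mu B).
Proof.
elim: L B omega0 => [//|x L IH] B omega0 mB /= /andP[xL uL].
have step b : bernoulli_mean (1 / (1 + lambda)) L
    (fun omega => fine (mu (run adj q omega (x :: L) @^-1` B)))
    [eta omega0 with x |-> b] = fine (mu (heat_bath adj b (q x) @^-1` B)).
  rewrite -(IH _ [eta omega0 with x |-> b]) //; last first.
    exact: (measurable_heat_bath lambda_gt0 gibbs).
  (* [x] is not in [L], so its trap keeps the value [b] throughout the average over [L]. *)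
  apply: eq_bernoulli_mean => omega /(_ _ xL) /=; rewrite eqxx => omx.
  by rewrite -omx.
by rewrite !step -gibbs_heat_bath.
Qed.

End Run.

Variables mu nu : probability (config W) R.
Hypothesis gibbs_mu : hardcore_gibbs adj lambda mu.
Hypothesis gibbs_nu : hardcore_gibbs adj lambda nu.

(** A coupling: the same traps drive the run from [mu] and from [nu]. Unless a vertex of [map f U]
    is undecided, the run lies in [B] for all initial configurations or for none; otherwise the two
    probabilities differ by at most 1. *)
Lemma gibbs_dist (U : seq W) (n : nat) (B := [set eta : config W | all eta U]) :
  measurable B ->
  ((`|fine (mu B) - fine (nu B)|)%:E <=
   P [set omega : config V | has (undecided n.+1 omega) (map f U)])%E.
Proof.
move=> mB.
have [u /mapP[w _ ->]|L0 L0lev L0ex] :=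
  @exploration _ outs lev m lev_outs (map f U) n 0.
  by have /andP[] := f_lev w.
pose L := sort (relpre lev <=%R) (undup L0).
have memL x : (x \in L) = (x \in L0) by rewrite mem_sort mem_undup.
have uL : uniq L by rewrite sort_uniq undup_uniq.
have sL : sorted (relpre lev <=%R) L.
  by apply: sort_sorted => x y; exact: le_total.
have exL w : w \in U -> explored outs L n (f w).
  move=> wU; apply: (@explored_sub _ _ L0); first by move=> x; rewrite memL.
  by apply: L0ex; exact: map_f.
have mG := measurable_has_undecided n.+1 (map f U).
set G := [set omega | _] in mG *.
have p01 : 0 <= 1 / (1 + lambda) <= 1.
  rewrite div1r invr_ge0 invf_le1 ?addr_gt0 // ?lerDl ?(ltW lambda_gt0) ?andbT //.
  by rewrite addr_ge0 // ltW.
(* Horizon [n.+1] reads traps up to [n] moves ahead, all in [L], so the probability of the undecided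
   event is a finite average over [L]. *)
rewrite -(bernoulli_mean_indic hP (fun=> false) mG _ uL); last first.
  move=> omega omega' h /hasP[_ /mapP[w wU ->] /andP[h1 h2]].
  apply/hasP; exists (f w); first exact: map_f.
  by rewrite /undecided -!(status_local _ h (exL _ wU)) h1.
rewrite -(gibbs_run gibbs_mu (fun=> false) mB uL).
rewrite -(gibbs_run gibbs_nu (fun=> false) mB uL) lee_fin.
apply: bernoulli_mean_dist => // omega; rewrite indicE.
have mR := measurable_run gibbs_mu omega L mB.
set C := run adj q omega L @^-1` B in mR *.
have [_|/negP nG] := boolP (omega \in G).
  have bnd (k : probability (config W) R) : 0 <= fine (k C) <= 1.
    rewrite fine_ge0 ?measure_ge0 //=.
    by rewrite -lee_fin fineK ?probability_le1 //; exact: fin_num_measure.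
  have /andP[a1 a2] := bnd mu; have /andP[b1 b2] := bnd nu.
  by rewrite -[true%:R]/(1 : R) ler_norml; apply/andP; split; lra.
(* Off the undecided event the lower and upper statuses of [f w] coincide, and [run_sandwich] pins
   the final value at [w] to them. *)
have same eta eta' : C eta -> C eta'.
  rewrite /C /B /= => /allP h; apply/allP => w wU.
  have win z : z \in L -> lev (f w) < lev z + m.
    rewrite memL => /L0lev z0; have /andP[_ h2] := f_lev w.
    by apply: lt_le_trans h2 _; rewrite lerDr.
  have sw et := @run_sandwich _ _ _ _ _ _ _ lev_outs adj_q q_inj omega et L n
    (f w) sL uL win (exL _ wU).
  rewrite fK in sw; apply: (proj1 (sw _)).
  have /(proj2 (sw _)) hi := h _ wU.
  apply/negPn/negP => lo; apply: nG; apply/mem_set; apply/hasP.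
  by exists (f w); [exact: map_f|rewrite /undecided hi lo].
have [[eta Ceta]|h] := pselect (exists eta, C eta).
  have -> : C = setT by apply/seteqP; split=> // eta' _; exact: same Ceta.
  by rewrite !probability_setT subrr normr0.
have -> : C = set0 by apply/seteqP; split=> // eta Ceta; apply: h; exists eta.
by rewrite !measure0 subrr normr0.
Qed.

Hypothesis no_draw : forall x, P [set omega : config V | draw E omega x] = 0%E.

(** The events that all sites of a finite list are occupied form a generating pi-system, and on each
    of them the bound of [gibbs_dist] tends to 0. *)
Lemma gibbs_unique (A : set (config W)) : measurable A -> mu A = nu A.
Proof.
pose G : set (set (config W)) :=
  [set B | exists U : seq W, B = [set eta : config W | all eta U]].
have mall (U : seq W) : measurable [set eta : config W | all eta U].
  elim: U => [|w U IH] /=.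
    by rewrite (_ : [set _ | _] = setT) //; apply/seteqP; split.
  rewrite (_ : [set _ | _] = [set eta : config W | eta w = true] `&`
    [set eta : config W | all eta U]).
    by apply: measurableI => //; exact: measurable_coord.
  by apply/seteqP; split=> eta /= /andP.
have GT : G setT by exists [::]; apply/seteqP; split.
move=> mA; apply: (@g_sigma_algebra_measure_unique _ _ _ G _ (fun=> setT)) => //.
- by move=> B [U ->].
- by apply/seteqP; split=> // eta _; exists 0%N.
- move=> B C [U ->] [U' ->]; exists (U ++ U'); apply/seteqP.
  by split=> eta /=; rewrite all_cat => /andP.
- move=> B [U ->]; set B' := [set eta | _].
  have fin (k : probability (config W) R) : k B' \is a fin_num.
    by apply: fin_num_measure; exact: mall.
  apply: etrans (esym (fineK (fin mu))) _; apply: etrans _ (fineK (fin nu)).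
  congr (_%:E).
  apply/eqP; rewrite -subr_eq0 -normr_le0 -lee_fin.
  apply: cvge_ge (has_undecided_cvg (fun x (_ : x \in map f U) => no_draw x)).
  (* [gibbs_dist] speaks of horizons [n.+1], so the bound holds from index 1 on. *)
  by exists 1%N => // -[//|n] _; apply: gibbs_dist; exact: mall.
- move=> k; apply: le_lt_trans (ltry 1); exact: probability_le1.
- move: mA; apply: smallest_sub; first exact: smallest_sigma_algebra.
  move=> _ [v _ [Y _ <-]]; rewrite setTI.
  have sT : <<s G >> [set eta : W -> bool | eta v = true].
    apply: sub_sigma_algebra; exists [:: v].
    by apply/seteqP; split=> eta /=; rewrite andbT.
  have [yt|yt] := pselect (Y true); have [yf|yf] := pselect (Y false).
  + rewrite (_ : _ @^-1` _ = setT); first exact: sub_sigma_algebra.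
    by apply/seteqP; split=> eta //= _; case: (eta v).
  + rewrite (_ : _ @^-1` _ = [set eta : W -> bool | eta v = true]) //.
    by apply/seteqP; split=> eta /=; case: (eta v).
  + rewrite (_ : _ @^-1` _ = ~` [set eta : W -> bool | eta v = true]).
      exact: sigma_algebraC.
    by apply/seteqP; split=> eta /=; case: (eta v).
  + rewrite (_ : _ @^-1` _ = set0); first exact: sigma_algebra0.
    by apply/seteqP; split=> eta //=; case: (eta v).
Qed.

End Uniqueness.

(** * Levels and projection from the partition and the automorphism, and the conclusion by
    contraposition *)

Theorem theorem2 (R : realType) (V : Type) (E : V -> V -> Prop)
    (S : int -> set V) (m : int) (phi : V -> V)
    (W : Type) (adj : W -> W -> Prop) (lambda : R)
    (P : probability (config V) R) :
  locally_finite E ->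
  classical_sets.partition [set: int] S [set: V] ->
  2 <= m ->
  (forall (k : int) (x : V), S k x ->
     out_nbrs E x `<=` layers S (k + 1) (k + m - 1)) ->
  graph_iso E E phi ->
  (forall k : int, phi @` S k = S (k + m)) ->
  (forall x : V, out_nbrs E x = in_nbrs E (phi x)) ->
  (forall k : int, exists f : W -> layers S k (k + m - 1),
     graph_iso adj (@induced_undirected V E (layers S k (k + m - 1))) f) ->
  0 < lambda ->
  multiple_hardcore_gibbs adj lambda ->
  bernoulli_product (1 / (1 + lambda)) P ->
  exists x : V,
    measurable [set omega : config V | draw E omega x] /\
    (0 < P [set omega : config V | draw E omega x])%E.
Proof.
move=> lfE [Scov Striv _] m2 A1 [phi_bij phi_E] phiS phi_in isoD l0 multi hP.
apply: contrapT => nodraw.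
have /choice[lev lev_mem] : forall x, exists k, S k x.
  by move=> x; have [k _ kx] : cover setT S x by [rewrite Scov]; exists k.
have levE k x : S k x -> lev x = k.
  move=> kx; apply: (Striv (lev x) k) => //; exists x; split=> //; exact: lev_mem.
(* [{classic V}] equips the arbitrary type [V] with the choice structure used for sequences and
   membership. *)
have /choice[outs outsE] : forall x : V,
    exists s : seq {classic V}, out_nbrs E x = [set` s].
  by move=> x; apply/(@finite_seqP {classic V}); have [] := lfE x.
have outsP (x y : {classic V}) : E x y <-> y \in outs x.
  by have := outsE x => /predeqP/(_ y).
have lev_E x y : E x y -> lev x < lev y < lev x + m.
  move=> xy; have [i /= /andP[i1 i2] iy] := A1 _ _ (lev_mem x) _ xy.
  by rewrite (levE _ _ iy); lia.
have phi_lev x : lev (phi x) = lev x + m.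
  by apply: levE; rewrite -phiS; exists x => //; exact: lev_mem.
have phi_inE x y : E x y <-> E y (phi x) by have /predeqP/(_ y) := phi_in x.
have [g [[h gK hK] g_adj]] := isoD 0.
pose f (w : W) : V := val (g w).
have f_inj : injective f by move=> w w' /val_inj/(can_inj gK).
have f_lev w : 0 <= lev (f w) < m.
  have /set_mem[i /= /andP[i1 i2] iw] := valP (g w).
  by rewrite (levE _ _ iw); lia.
have f_surj x : 0 <= lev x < m -> exists w, f w = x.
  move=> hx; have xl : x \in layers S 0 (0 + m - 1).
    by apply/mem_set; exists (lev x); [move: hx => /=; lia|exact: lev_mem].
  by exists (h (SigSub xl)); rewrite /f hK.
have f_adj w w' : adj w w' <-> E (f w) (f w') \/ E (f w') (f w) by exact: g_adj.
have [q [adj_q q_inj fK]] := @orbit_projection {classic V} {classic W} E lev m phi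
  m2 lev_E phi_bij phi_E phi_lev phi_inE adj f f_inj f_lev f_surj f_adj.
have lev_outs (x y : {classic V}) : y \in outs x -> lev x < lev y < lev x + m.
  by move=> /outsP/lev_E.
have adj_q' x w : adj (q x) w <-> exists2 y : {classic V}, y \in outs x & q y = w.
  by rewrite adj_q; split=> -[y /outsP xy yw]; exists y.
(* The draw event is measurable, so failure of the conclusion at [x] leaves it probability 0. *)
have null x : P [set omega : config V | draw E omega x] = 0%E.
  apply/eqP; rewrite eq_le measure_ge0 andbT leNgt; apply/negP => pos.
  apply: nodraw; exists x; split=> //.
  exact: (@measurable_draw {classic V} E outs outsP).
have [mu [nu [gmu gnu [A mA]]]] := multi; apply.
exact: (@gibbs_unique R {classic V} {classic W} E outs adj q f lev m lambda outsP
  lev_outs adj_q' q_inj fK f_lev l0 P hP mu nu gmu gnu null A mA).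
Qed.
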